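(* Let $g:\mathbb{R}^m\to\mathbb{R}$ be a (not necessarily convex) Fréchet differentiable function whose gradient is $L_g$-Lipschitz continuous, let $\alpha>0$, $\beta\in(0,1)$, $0<s<\frac{2(1-\beta)}{L_g}$, let $x_0,x_{-1}\in\mathbb{R}^m$, and let $(x_n)_{n\in\mathbb{N}},(y_n)_{n\in\mathbb{N}}$ be generated, for all $n\in\mathbb{N}$, by $$y_n=x_n+\frac{\beta n}{n+\alpha}(x_n-x_{n-1}),\qquad x_{n+1}=y_n-s\nabla g(y_n).$$ Assume that $g$ is bounded from below and consider $H:\mathbb{R}^m\times\mathbb{R}^m\to\mathbb{R}$, $H(x,y)=g(x)+\frac12\|x-y\|^2$. Let $(z_n)_{n\in\mathbb{N}}$ be the sequence in $\mathbb{R}^m\times\mathbb{R}^m$ defined in the context. Assume that the set $\omega((z_n)_{n\in\mathbb{N}})$ of cluster points of $(z_n)$ is nonempty and that $H$ fulfills the Łojasiewicz property with Łojasiewicz constant $K$ and Łojasiewicz exponent $\theta\in[0,1)$ at a point $z^*=(x^*,x^* )\in\omega((z_n)_{n\in\mathbb{N}})$. Then $\lim_{n\to+\infty}x_n=x^*$, $\nabla g(x^* )=0$, and the following statements hold true. If $\theta=0$, then: (a$_0$) $(g(y_n))_{n\in\mathbb{N}}$, $(g(x_n))_{n\in\mathbb{N}}$, $(y_n)_{n\in\mathbb{N}}$ and $(x_n)_{n\in\mathbb{N}}$ converge in a finite number of steps. If $\theta\in\left(0,\frac12\right]$, then there exist $Q\in[0,1)$, $a_1,a_2,a_3,a_4>0$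 and $\overline{k}\in\mathbb{N}$ such that for every $n\ge\overline{k}$: (a$_1$) $g(y_n)-g(x^* )\le a_1Q^n$; (a$_2$) $g(x_n)-g(x^* )\le a_2Q^n$; (a$_3$) $\|x_n-x^*\|\le a_3Q^{\frac n2}$; (a$_4$) $\|y_n-x^*\|\le a_4Q^{\frac n2}$. If $\theta\in\left(\frac12,1\right)$, then there exist $b_1,b_2,b_3,b_4>0$ and $\overline{k}\in\mathbb{N}$ such that for all $n\ge\overline{k}$: (b$_1$) $g(y_n)-g(x^* )\le b_1n^{-\frac{1}{2\theta-1}}$; (b$_2$) $g(x_n)-g(x^* )\le b_2n^{-\frac{1}{2\theta-1}}$; (b$_3$) $\|x_n-x^*\|\le b_3n^{\frac{\theta-1}{2\theta-1}}$; (b$_4$) $\|y_n-x^*\|\le b_4n^{\frac{\theta-1}{2\theta-1}}$.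
   Context: $\mathbb{N}=\{0,1,2,\dots\}$; $\|\cdot\|$ is the Euclidean norm ($\mathbb{R}^m\times\mathbb{R}^m$ carries the Euclidean norm of $\mathbb{R}^{2m}$). $L_g$-Lipschitz gradient means: $L_g\ge 0$ and $\|\nabla g(x)-\nabla g(y)\|\le L_g\|x-y\|$ for all $x,y$. A sequence converges in a finite number of steps if it is eventually constant (equal to its limit). Definition of $(z_n)$. For $n\in\mathbb{N}$, $n\ge1$, let $$A_{n-1}=\frac{2-sL_g}{2s}\left(\frac{(1+\beta)n+\alpha}{n+\alpha}\right)^2-\frac{\beta n((1+\beta)n+\alpha)}{s(n+\alpha)^2},\qquad B_n=\frac{2-sL_g}{2s}\left(\frac{\beta n}{n+\alpha}\right)^2,$$ $$C_{n-1}=\frac{2-sL_g}{2s}\,\frac{\beta n-\beta}{n+\alpha-1}\,\frac{(1+\beta)n+\alpha}{n+\alpha}-\frac1{2s}\,\frac{\beta n-\beta}{n+\alpha-1}\,\frac{\beta n}{n+\alpha},$$ $$\delta_n=\tfrac12(A_{n-1}-C_{n-1}-B_n+C_n).$$ There exists $N\in\mathbb{N}$, $N\ge1$, such that $\delta_n>0$ for all $n\ge N$ and the sequence $(g(y_n)+\delta_n\|x_n-x_{n-1}\|^2)_{n\ge N}$ is nonincreasing; fix such an $N$. For $n\ge N$ put $u_n=y_n+\sqrt{2\delta_n}\,(x_n-x_{n-1})$, and for $n\in\mathbb{N}$ put $z_n=(y_{n+N},u_{n+N})$. Łojasiewicz property. A differentiable function $f:\mathbb{R}^d\to\mathbb{R}$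 fulfills the Łojasiewicz property at a critical point $\overline{x}$ of $f$ (i.e. $\nabla f(\overline{x})=0$) if there exist $K,\epsilon>0$ and $\theta\in[0,1)$ such that $|f(x)-f(\overline{x})|^\theta\le K\|\nabla f(x)\|$ for every $x$ with $\|x-\overline{x}\|<\epsilon$. $K$ is called the Łojasiewicz constant and $\theta$ the Łojasiewicz exponent of $f$ at $\overline{x}$. For $\theta=0$ the convention $0^0=0$ is adopted, so that $|f(x)-f(\overline{x})|^0=0$ if $f(x)=f(\overline{x})$. *)

(* Defs.v *)
From HB Require Import structures.
From mathcomp Require Import all_boot all_order all_algebra.
From mathcomp Require Import all_classical all_reals all_analysis.
Set Implicit Arguments.
Unset Strict Implicit.
Unset Printing Implicit Defensive.
Import Order.TTheory GRing.Theory Num.Theory.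
Import numFieldNormedType.Exports.

Local Open Scope classical_set_scope.
Local Open Scope ring_scope.

(* The library norm `|.| on 'rV[R]_d is the sup norm. It induces the same
   topology and the same notion of differentiability as the Euclidean norm,
   but Lipschitz and Lojasiewicz constants depend on the norm. *)
Definition enorm (R : realType) (d : nat) (v : 'rV[R]_d) : R :=
  Num.sqrt (\sum_(i < d) v ord0 i ^+ 2).

(* For f differentiable at x, this is the vector representing the Frechet
   derivative 'd f x with respect to the Euclidean inner product. *)
Definition grad (R : realType) (d : nat) (f : 'rV[R]_d -> R) (x : 'rV[R]_d) :
    'rV[R]_d :=
  \row_(i < d) 'd f x (delta_mx ord0 i).

Definition lipschitz_grad (R : realType) (d : nat) (f : 'rV[R]_d -> R)
    (L : R) : Prop :=
  0 <= L /\
  forall x y : 'rV[R]_d, enorm (grad f x - grad f y) <= L * enorm (x - y).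

(* Real power of a nonnegative number with 0 ^ 0 = 0 (powR has 0 `^ 0 = 1). *)
Definition pow00 (R : realType) (t theta : R) : R :=
  if t == 0 then 0 else t `^ theta.

(* Criticality of xbar is deliberately not part of the definition: for the
   cluster points considered here it is a consequence, not an assumption. *)
Definition lojasiewicz_at (R : realType) (d : nat) (f : 'rV[R]_d -> R)
    (xbar : 'rV[R]_d) (K theta : R) : Prop :=
  [/\ 0 < K, 0 <= theta < 1 &
      exists2 eps : R, 0 < eps &
        forall x : 'rV[R]_d, enorm (x - xbar) < eps ->
          pow00 `|f x - f xbar| theta <= K * enorm (grad f x)].

(* The term x_(n-1) of a sequence indexed from -1, given as x_(-1) = xm1
   together with (x_n)_(n >= 0). *)
Definition xprev (T : Type) (xm1 : T) (x : nat -> T) (n : nat) : T :=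
  if n is k.+1 then x k else xm1.

Section coefficients.
Variables (R : realType) (alpha beta s Lg : R).

(* With n = k + 1, coefA k and coefC k are A_(n-1) and C_(n-1). *)
Definition coefA (k : nat) : R :=
  let n : R := k.+1%:R in
  (2 - s * Lg) / (2 * s) * (((1 + beta) * n + alpha) / (n + alpha)) ^+ 2
  - beta * n * ((1 + beta) * n + alpha) / (s * (n + alpha) ^+ 2).

Definition coefB (k : nat) : R :=
  let n : R := k%:R in
  (2 - s * Lg) / (2 * s) * (beta * n / (n + alpha)) ^+ 2.

Definition coefC (k : nat) : R :=
  let n : R := k.+1%:R in
  (2 - s * Lg) / (2 * s) * ((beta * n - beta) / (n + alpha - 1))
    * (((1 + beta) * n + alpha) / (n + alpha))
  - 1 / (2 * s) * ((beta * n - beta) / (n + alpha - 1))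
    * (beta * n / (n + alpha)).

(* Meaningful for n >= 1 only. *)
Definition delta (n : nat) : R :=
  1 / 2 * (coefA n.-1 - coefC n.-1 - coefB n + coefC n).

End coefficients.

(* R^m x R^m is 'rV[R]_(m + m), with (x, y) encoded as row_mx x y, so that
   enorm on it is the Euclidean norm of R^(2m). *)
Definition Hfun (R : realType) (m : nat) (g : 'rV[R]_m -> R)
    (w : 'rV[R]_(m + m)) : R :=
  g (lsubmx w) + 1 / 2 * enorm (lsubmx w - rsubmx w) ^+ 2.

Definition useq (R : realType) (m : nat) (alpha beta s Lg : R)
    (xm1 : 'rV[R]_m) (x y : nat -> 'rV[R]_m) (n : nat) : 'rV[R]_m :=
  y n + Num.sqrt (2 * delta alpha beta s Lg n) *: (x n - xprev xm1 x n).

Definition zseq (R : realType) (m : nat) (alpha beta s Lg : R)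
    (xm1 : 'rV[R]_m) (x y : nat -> 'rV[R]_m) (N n : nat) : 'rV[R]_(m + m) :=
  row_mx (y (n + N)%N) (useq alpha beta s Lg xm1 x y (n + N)).

Definition omega (R : realType) (d : nat) (z : nat -> 'rV[R]_d) :
    set 'rV[R]_d :=
  cluster (z @ \oo).

Definition converges_finitely (T : Type) (u : nat -> T) : Prop :=
  exists (l : T) (k : nat), forall n : nat, (k <= n)%N -> u n = l.

(* Main.v *)
(* Write d_n = x_n - x_(n-1), w_n = |d_n| + |d_(n+1)| and
   e_n = H(z_n) - g(xstar) = g(y_n) + delta_n |d_n|^2 - g(xstar). Inserting the
   iteration into the descent lemma for g gives, for large n, the decrease
   D w_n^2 <= e_n - e_(n+1), while grad H(z_n) is a combination of d_n and
   d_(n+1), so that the Lojasiewicz inequality reads e_n^theta <= K' w_n as long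
   as z_n is close to the limit point. By concavity of t^(1 - theta) the two
   combine into w_n <= C (e_n^(1-theta) - e_(n+1)^(1-theta)); this telescopes,
   which traps the sequence near xstar and gives
   |x_n - xstar| <= C e_n^(1-theta).
   The rates then follow from e_n^(2 theta) <= M (e_n - e_(n+1)). *)
Require Import Defs.
From HB Require Import structures.
From mathcomp Require Import all_boot all_order all_algebra.
From mathcomp Require Import all_classical all_reals all_analysis.
From mathcomp Require Import ring lra zify.
Set Implicit Arguments.
Unset Strict Implicit.
Unset Printing Implicit Defensive.
Import Order.TTheory GRing.Theory Num.Theory.
Import numFieldNormedType.Exports.

Local Open Scope classical_set_scope.
Local Open Scope ring_scope.

(** * Tangent inequalities for real powers *)

(** Weighted arithmetic-geometric mean. With [t] the tangent value, [ln z <= z - 1] is applied at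
    [r / t] and [1 / t] with weights [q] and [1 - q]; the weighted right-hand sides cancel, leaving
    [q * ln r <= ln t]. *)
Lemma powR_le_tangent (R : realType) (r q : R) :
  0 <= r -> 0 < q <= 1 -> r `^ q <= 1 + q * (r - 1).
Proof.
rewrite le_eqVlt => /predU1P[<-|r0] /andP[q0 q1].
  by rewrite powR0 ?gt_eqF//; lra.
have t0 : 0 < 1 + q * (r - 1) by nra.
set t := 1 + _ in t0 *.
rewrite -ler_ln ?posrE ?powR_gt0// ln_powR.
have h1 : ln (r / t) <= r / t - 1.
  have -> : r / t = 1 + (r / t - 1) by lra.
  by apply: (le_trans (le_ln1Dx _)); [have : 0 < r / t by rewrite divr_gt0|]; lra.
have h2 : ln (1 / t) <= 1 / t - 1.
  have -> : 1 / t = 1 + (1 / t - 1) by lra.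
  by apply: (le_trans (le_ln1Dx _)); [have : 0 < 1 / t by rewrite divr_gt0|]; lra.
rewrite !ln_div ?posrE// ln1 in h1 h2.
have h3 : q * (r / t - 1) + (1 - q) * (1 / t - 1) = 0.
  by rewrite /t; field; rewrite gt_eqF.
nra.
Qed.

(** Concavity of [t ^ q] at an arbitrary point: the tangent inequality at [b / a], rescaled by
    [a ^ q]. *)
Lemma powRB_ge (R : realType) (a b q : R) :
  0 < a -> 0 <= b -> 0 < q <= 1 ->
  q * a `^ (q - 1) * (a - b) <= a `^ q - b `^ q.
Proof.
move=> a0 b0 hq.
have := powR_le_tangent (divr_ge0 b0 (ltW a0)) hq.
have -> : b `^ q = a `^ q * (b / a) `^ q.
  rewrite -powRM ?divr_ge0 ?(ltW a0)//; congr (_ `^ _); field; exact: lt0r_neq0.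
have -> : a `^ (q - 1) = a `^ q / a.
  by rewrite powRB ?powRr1 ?(ltW a0)//; apply/implyP => _; rewrite gt_eqF.
have A0 : 0 < a `^ q by rewrite powR_gt0.
move: A0; set A := a `^ q; set r := (b / a) `^ q => A0 h.
have -> : q * (A / a) * (a - b) = - (A * (q * (b / a - 1))).
  by field; exact: lt0r_neq0.
nra.
Qed.

Lemma powRN_ge_tangent (R : realType) (r p : R) :
  0 < r -> 0 <= p -> 1 + p * (1 - r) <= r `^ (- p).
Proof.
move=> r0 p0; rewrite /powR gt_eqF//.
apply: le_trans (expR_ge1Dx _).
have : ln r <= r - 1.
  by have := @le_ln1Dx R (r - 1); rewrite (_ : 1 + (r - 1) = r); [apply; lra|lra].
nra.
Qed.

(** Convexity of [t ^ (- p)], by the same rescaling. It makes negative powers of the energy grow at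
    least linearly in the sublinear regime. *)
Lemma powRN_diff_ge (R : realType) (a b p : R) :
  0 < a -> 0 < b -> 0 <= p ->
  p * a `^ (- (p + 1)) * (a - b) <= b `^ (- p) - a `^ (- p).
Proof.
move=> a0 b0 p0.
have := powRN_ge_tangent (divr_gt0 b0 a0) p0.
have -> : b `^ (- p) = a `^ (- p) * (b / a) `^ (- p).
  rewrite -powRM ?divr_ge0 ?(ltW a0) ?(ltW b0)//.
  by congr (_ `^ _); field; exact: lt0r_neq0.
have -> : a `^ (- (p + 1)) = a `^ (- p) / a.
  rewrite opprD powRB ?powRr1 ?(ltW a0)//.
  by apply/implyP => _; rewrite gt_eqF.
have A0 : 0 < a `^ (- p) by rewrite powR_gt0.
move: A0; set A := a `^ (- p); set r := (b / a) `^ (- p) => A0 h.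
have -> : p * (A / a) * (a - b) = A * (p * (1 - b / a)).
  by field; exact: lt0r_neq0.
nra.
Qed.

(** * The Euclidean norm *)

Section euclidean.
Variables (R : realType) (d : nat).
Implicit Types (u v w : 'rV[R]_d) (a : R).

Definition dot u v : R := \sum_(i < d) u ord0 i * v ord0 i.

Lemma dotC u v : dot u v = dot v u.
Proof. by apply: eq_bigr => i _; rewrite mulrC. Qed.

Lemma dotDl u v w : dot (u + v) w = dot u w + dot v w.
Proof. by rewrite -big_split; apply: eq_bigr => i _; rewrite mxE mulrDl. Qed.

Lemma dotZl a u v : dot (a *: u) v = a * dot u v.
Proof. by rewrite mulr_sumr; apply: eq_bigr => i _; rewrite mxE mulrA. Qed.

Lemma dotNl u v : dot (- u) v = - dot u v.
Proof. by rewrite -scaleN1r dotZl mulN1r. Qed.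

Lemma dotDr u v w : dot w (u + v) = dot w u + dot w v.
Proof. by rewrite ![dot w _]dotC dotDl. Qed.

Lemma dotZr a u v : dot v (a *: u) = a * dot v u.
Proof. by rewrite ![dot v _]dotC dotZl. Qed.

Lemma dotNr u v : dot v (- u) = - dot v u.
Proof. by rewrite ![dot v _]dotC dotNl. Qed.

Lemma enorm_ge0 u : 0 <= enorm u.
Proof. exact: sqrtr_ge0. Qed.

Lemma sqr_enorm u : enorm u ^+ 2 = dot u u.
Proof.
by rewrite sqr_sqrtr ?sumr_ge0// => i _; exact: sqr_ge0.
Qed.

Lemma enormZ a u : enorm (a *: u) = `|a| * enorm u.
Proof.
apply/(@pexpIrn _ 2) => //; rewrite ?nnegrE ?mulr_ge0 ?enorm_ge0//.
by rewrite exprMn !sqr_enorm dotZl dotZr real_normK ?num_real//; ring.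
Qed.

Lemma enormN u : enorm (- u) = enorm u.
Proof. by rewrite -scaleN1r enormZ normrN1 mul1r. Qed.

Lemma enormBC u v : enorm (u - v) = enorm (v - u).
Proof. by rewrite -enormN opprB. Qed.

Lemma enorm0 : enorm (0 : 'rV[R]_d) = 0.
Proof. by rewrite -(scale0r 0) enormZ normr0 mul0r. Qed.

Lemma enorm_eq0 u : enorm u = 0 -> u = 0.
Proof.
move=> h; have := sqr_enorm u; rewrite h expr0n /= => /esym/eqP.
rewrite psumr_eq0; last by move=> i _; exact: sqr_ge0.
move=> /allP hu; apply/rowP => i; rewrite mxE.
by have := hu i (mem_index_enum _); rewrite mulf_eq0 orbb => /eqP.
Qed.

(** Cauchy-Schwarz, read off from the squared norm of [enorm v *: u - enorm u *: v]. *)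
Lemma dot_le u v : dot u v <= enorm u * enorm v.
Proof.
have [/enorm_eq0->|u0] := eqVneq (enorm u) 0.
  by rewrite /dot enorm0 mul0r big1// => i _; rewrite mxE mul0r.
have [/enorm_eq0->|v0] := eqVneq (enorm v) 0.
  by rewrite /dot enorm0 mulr0 big1// => i _; rewrite mxE mulr0.
have U0 : 0 < enorm u by rewrite lt0r u0 enorm_ge0.
have V0 : 0 < enorm v by rewrite lt0r v0 enorm_ge0.
have := sqr_ge0 (enorm (enorm v *: u - enorm u *: v)).
rewrite sqr_enorm !(dotDl, dotDr, dotNl, dotNr, dotZl, dotZr).
rewrite (dotC v u) -!sqr_enorm.
move: U0 V0; set U := enorm u; set V := enorm v => U0 V0 h.
have h2 : 0 <= (U * V) * (U * V - dot u v) by nra.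
by rewrite -subr_ge0 -(pmulr_rge0 _ (mulr_gt0 U0 V0)).
Qed.

Lemma enormD u v : enorm (u + v) <= enorm u + enorm v.
Proof.
rewrite -(@ler_pXn2r _ 2) ?nnegrE ?addr_ge0 ?enorm_ge0//.
rewrite sqr_enorm !(dotDl, dotDr) (dotC v u) -!sqr_enorm.
have := dot_le u v; nra.
Qed.

Lemma enormB u v : enorm (u - v) <= enorm u + enorm v.
Proof. by rewrite -(enormN v) enormD. Qed.

Lemma enorm_triangle u v w : enorm (u - w) <= enorm (u - v) + enorm (v - w).
Proof. by rewrite (_ : u - w = (u - v) + (v - w)) ?enormD// addrA subrK. Qed.

Lemma coord_le_norm u i : `|u ord0 i| <= `|u|.
Proof.
rewrite [leRHS]/Num.Def.normr /= mx_normrE.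
exact: (le_bigmax _ (fun ij => `|u ij.1 ij.2|) (ord0, i)).
Qed.

(** Together with [norm_le_enorm] this passes between the sup-norm topology and Euclidean estimates;
    the crude factor [d] suffices for that. *)
Lemma enorm_le_norm u : enorm u <= d%:R * `|u|.
Proof.
rewrite -(@ler_pXn2r _ 2) ?nnegrE ?mulr_ge0 ?enorm_ge0//.
rewrite sqr_enorm exprMn.
apply: (@le_trans _ _ (\sum_(i < d) `|u| ^+ 2)).
  apply: ler_sum => i _.
  rewrite -expr2 -(real_normK (num_real (u ord0 i))).
  by rewrite ler_pXn2r ?nnegrE// coord_le_norm.
rewrite sumr_const card_ord -[_ *+ d]mulr_natl ler_wpM2r ?sqr_ge0//.
by rewrite -natrX ler_nat; case: (d) => // k; rewrite expnS leq_pmulr// expn_gt0.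
Qed.

Lemma norm_le_enorm u : `|u| <= enorm u.
Proof.
rewrite [leLHS]/Num.Def.normr /= mx_normrE.
apply: bigmax_le; first exact: enorm_ge0.
move=> [i j] _ /=; rewrite (ord1 i).
rewrite -(@ler_pXn2r _ 2) ?nnegrE ?enorm_ge0//.
rewrite real_normK ?num_real// sqr_enorm /dot (bigD1 j)//= -expr2 lerDl.
by apply: sumr_ge0 => k _; exact: sqr_ge0.
Qed.

End euclidean.

(** * The Euclidean norm on a product *)

Section row_mx.
Variables (R : realType) (m n : nat).
Implicit Types (a : 'rV[R]_m) (b : 'rV[R]_n).

Lemma dot_row_mx a b a' b' :
  dot (row_mx a b) (row_mx a' b') = dot a a' + dot b b'.
Proof.
rewrite /dot big_split_ord /=; congr (_ + _); apply: eq_bigr => i _.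
  by rewrite !row_mxEl.
by rewrite !row_mxEr.
Qed.

Lemma sqr_enorm_row_mx a b :
  enorm (row_mx a b) ^+ 2 = enorm a ^+ 2 + enorm b ^+ 2.
Proof. by rewrite !sqr_enorm dot_row_mx. Qed.

Lemma enorm_row_mx_le a b : enorm (row_mx a b) <= enorm a + enorm b.
Proof.
rewrite -(@ler_pXn2r _ 2) ?nnegrE ?addr_ge0 ?enorm_ge0//.
rewrite sqr_enorm_row_mx; have := enorm_ge0 a; have := enorm_ge0 b; nra.
Qed.

Lemma enorm_le_row_mx a b : enorm a <= enorm (row_mx a b).
Proof.
rewrite -(@ler_pXn2r _ 2) ?nnegrE ?enorm_ge0//.
by rewrite sqr_enorm_row_mx lerDl sqr_ge0.
Qed.

End row_mx.

(** * Gradients *)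

Section gradient.
Variables (R : realType) (d : nat).
Implicit Types (f : 'rV[R]_d -> R) (u v w : 'rV[R]_d).

Lemma diff_dot_grad f u v : 'd f u v = dot (grad f u) v.
Proof.
rewrite {1}(row_sum_delta v) linear_sum; apply: eq_bigr => i _.
by rewrite linearZ/= mxE mulrC.
Qed.

Lemma grad_unique f u v :
  (forall w, 'd f u w = dot v w) -> grad f u = v.
Proof.
move=> h; apply/rowP => i; rewrite mxE h /dot (bigD1 i)//= mxE !eqxx mulr1.
by rewrite big1 ?addr0// => j ji; rewrite mxE (negPf ji) andbF mulr0.
Qed.

Lemma is_derive_line f u w (t : R) :
  (forall v, differentiable f v) ->
  is_derive t 1 (fun r => f (u + r *: w)) (dot (grad f (u + t *: w)) w).
Proof.
move=> df; set F := fun r : R => f (u + r *: w).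
(* The difference quotient of the restriction at [t] is the one of [f] at [u + t *: w] in direction
   [w]. *)
have E : (fun h : R => h^-1 *: ((F \o shift t) (h *: 1) - F t)) =
    (fun h : R =>
      h^-1 *: ((f \o shift (u + t *: w)) (h *: w) - f (u + t *: w))).
  apply/funext => h; rewrite /F /= /shift /=; congr (_ *: (f _ - _)).
  by rewrite [h *: 1]mulr1 scalerDl addrCA.
apply: DeriveDef; first by rewrite /derivable E; exact: diff_derivable.
by rewrite /derive E -/(derive f (u + t *: w) w) deriveE// diff_dot_grad.
Qed.

(* Otherwise unification unfolds them down to coordinates and diverges. *)
Opaque dot grad enorm.

(** Subtracting [c * t + q * t ^+ 2] from [f] along the segment leaves a function [h] whose
    derivative is at most 0 on the unit interval, by Cauchy-Schwarz and the Lipschitz bound at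
    distance [t * enorm w]. The claim is [h 1 <= h 0]. *)
Lemma descent_lemma f (L : R) u v :
  (forall v, differentiable f v) -> lipschitz_grad f L ->
  f v <= f u + dot (grad f u) (v - u) + L / 2 * enorm (v - u) ^+ 2.
Proof.
move=> df [L0 lip]; set w := v - u.
pose c := dot (grad f u) w; pose q := L / 2 * enorm w ^+ 2.
pose h := fun t : R => f (u + t *: w) - (c * t + q * t ^+ 2).
pose dh := fun t : R => dot (grad f (u + t *: w)) w - (c + q * (2 * t)).
have Dh (t : R) : is_derive t 1 h (dh t).
  have Dp : is_derive t 1 (fun r : R => c * r + q * r ^+ 2) (c + q * (2 * t)).
    have -> : (fun r : R => c * r + q * r ^+ 2) =
        c \*: (id : R -> R) + q \*: ((id : R -> R) ^+ 2) by [].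
    apply: is_derive_eq.
    by rewrite /GRing.scale /=; ring.
  exact: (is_deriveB (is_derive_line u w t df) Dp).
have cont : {within `[0, 1], continuous h}.
  apply: derivable_within_continuous => t _.
  by case: (Dh t).
have h10 : h 1 <= h 0.
  apply: (@ler0_derive1_nincr R h 0 1 _ _ cont) => // t.
  rewrite in_itv/= => /andP[t0 t1].
  rewrite derive1E derive_val.
  suff : dot (grad f (u + t *: w)) w - (c + q * (2 * t)) <= 0 by [].
  have := dot_le (grad f (u + t *: w) - grad f u) w.
  rewrite dotDl dotNl => h1.
  have := lip (u + t *: w) u.
  rewrite [X in _ <= L * enorm X](_ : _ = t *: w); last first.
    by rewrite addrAC subrr add0r.
  rewrite enormZ gtr0_norm// => h2.
  have h3 := ler_wpM2r (enorm_ge0 w) h2.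
  rewrite /c /q; move: h1 h3.
  generalize (dot (grad f (u + t *: w)) w) (dot (grad f u) w)
    (enorm (grad f (u + t *: w) - grad f u)) (enorm w) => a b e r h1 h3.
  by rewrite (_ : L / 2 * r ^+ 2 * (2 * t) = L * (t * r) * r); [lra|field].
move: h10; rewrite /h scale0r addr0 scale1r /w subrKC -/w -/c -/q.
by rewrite expr0n expr1n /= !(mulr0, mulr1) addr0 subr0 lerBlDr addrA.
Qed.

End gradient.

Lemma grad_Hfun (R : realType) (m : nat) (g : 'rV[R]_m -> R)
    (u v : 'rV[R]_m) : (forall p, differentiable g p) ->
  differentiable (Hfun g) (row_mx u v) /\
  grad (Hfun g) (row_mx u v) = row_mx (grad g u + (u - v)) (v - u).
Proof.
move=> dg.
pose G : 'rV[R]_(m + m) -> R := g \o lsubmx.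
pose q (i : 'I_m) : 'rV[R]_(m + m) -> R :=
  (fun w => w ord0 (lshift m i)) - (fun w => w ord0 (rshift m i)).
(* Written as a composition with a projection plus a sum of squares of linear coordinate functions,
   [Hfun g] is accessible to the calculus rules. *)
have HE : Hfun g = G + (1 / 2) \*: (\sum_(i < m) (q i) ^+ 2).
  apply/funext => w; rewrite /Hfun /G sqr_enorm /dot.
  rewrite fctE/=; congr (_ + _ * _).
  rewrite fct_sumE; apply: eq_bigr => i _.
  by rewrite !mxE.
have dG : differentiable G (row_mx u v).
  by apply: differentiable_comp => //; exact: differentiable_lsubmx.
have dc (i : 'I_(m + m)) w :
    is_derive (row_mx u v) w (fun w : 'rV[R]_(m + m) => w ord0 i) (w ord0 i).
  apply: DeriveDef; first exact/diff_derivable/differentiable_coord.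
  have /matrixP/(_ ord0 i) := derive_mx (@derivable_id _ _ (row_mx u v) w).
  by rewrite derive_id mxE.
have dq i w :
    is_derive (row_mx u v) w (q i) (lsubmx w ord0 i - rsubmx w ord0 i).
  by rewrite !mxE; exact: is_deriveB.
have dH : differentiable (Hfun g) (row_mx u v).
  rewrite HE; apply: differentiableD => //; apply: differentiableZ.
  apply: differentiable_sum => i; apply: differentiableX.
  apply: differentiableB; exact: differentiable_coord.
split=> //.
apply: grad_unique => w.
rewrite -deriveE//.
have DG : is_derive (row_mx u v) w G (dot (grad g u) (lsubmx w)).
  apply: DeriveDef; first exact: diff_derivable.
  rewrite deriveE// diff_comp//; last exact: differentiable_lsubmx.
  rewrite /= diff_lin; last exact: continuous_lsubmx.
  by rewrite row_mxKl diff_dot_grad.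
have DQ : is_derive (row_mx u v) w (Hfun g) (dot (grad g u) (lsubmx w)
    + 1 / 2 * \sum_(i < m) 2 * (u ord0 i - v ord0 i)
        * (lsubmx w ord0 i - rsubmx w ord0 i)).
  rewrite HE; apply: is_deriveD.
  apply: is_deriveZ; apply: is_derive_sum => i.
  apply: (is_derive_eq (is_deriveX 2 (dq i w))).
  have -> : q i (row_mx u v) = u ord0 i - v ord0 i.
    by rewrite -(row_mxEl u v) -(row_mxEr u v).
  by rewrite /GRing.scale /= expr1; ring.
rewrite derive_val -[in RHS](hsubmxK w) dot_row_mx dotDl -addrA; congr (_ + _).
rewrite /dot -big_split mulr_sumr; apply: eq_bigr => i _.
by rewrite !mxE /=; field.
Qed.

(** * Sequences satisfying a Lojasiewicz inequality *)

Section lojasiewicz_sequences.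
Variable R : realType.
Implicit Types (e w : nat -> R) (theta : R).

Lemma pow00E (t theta : R) : 0 < theta -> pow00 t theta = t `^ theta.
Proof.
by rewrite /pow00 => th0; case: eqVneq => // ->; rewrite powR0// gt_eqF.
Qed.

(** Concavity and the decrease bound the difference of powers below by
    [(1 - theta) * a ^ (- theta) * D * w ^+ 2], and the Lojasiewicz inequality says
    [K * w * a ^ (- theta) >= 1], which cancels one factor [w]. *)
Lemma lojasiewicz_step (theta D K a b w : R) :
  0 <= theta < 1 -> 0 < D -> 0 < K -> 0 <= a -> 0 <= b -> 0 <= w ->
  D * w ^+ 2 <= a - b -> pow00 a theta <= K * w ->
  w <= K / (D * (1 - theta)) * (a `^ (1 - theta) - b `^ (1 - theta)).
Proof.
move=> /andP[th0 th1] D0 K0 a0 b0 w0 hw.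
have q0 : 0 < 1 - theta by rewrite subr_gt0.
(* Here [a ^ (- theta)] has no meaning; the decrease forces [b = 0] and [w = 0]. *)
have [a_eq0 _|an0] := eqVneq a 0.
  have b_eq0 : b = 0 by nra.
  have -> : w = 0.
    have : w ^+ 2 <= 0 by nra.
    by move=> h; apply/eqP; rewrite -sqrf_eq0 eq_le h sqr_ge0.
  by rewrite a_eq0 b_eq0 subrr mulr0.
have {an0 a0}a0 : 0 < a by rewrite lt0r an0.
rewrite /pow00 (gt_eqF a0) => hK.
have A0 : 0 < a `^ theta by rewrite powR_gt0.
have q01 : 0 < 1 - theta <= 1 by apply/andP; split=> //; lra.
have := powRB_ge a0 b0 q01.
rewrite (_ : 1 - theta - 1 = - theta); last by ring.
rewrite powRN => hd.
have I0 : 0 < (a `^ theta)^-1 by rewrite invr_gt0.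
have h1 : 1 <= K * w * (a `^ theta)^-1.
  by rewrite -ler_pdivrMr ?invr_gt0// invrK mul1r.
move: hd I0 h1; set I := (a `^ theta)^-1; set d := _ - b `^ _ => hd I0 h1.
have Dq0 : 0 < D * (1 - theta) by rewrite mulr_gt0.
rewrite -(ler_pM2l Dq0).
rewrite (_ : _ * (K / _ * d) = K * d); last first.
  by field; rewrite !gt_eqF.
apply: (@le_trans _ _ (K * ((1 - theta) * I * (a - b)))); last first.
  by rewrite ler_pM2l.
apply: (@le_trans _ _ (K * ((1 - theta) * I * (D * w ^+ 2)))); last first.
  by rewrite ler_pM2l// ler_pM2l// mulr_gt0.
rewrite (_ : _ * (_ * I * _) = D * (1 - theta) * w * (K * w * I)); last by ring.
by rewrite ler_peMr// mulr_ge0// ltW.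
Qed.

Lemma nonincreasing_from e (n0 : nat) :
  (forall n, (n0 <= n)%N -> e n.+1 <= e n) ->
  forall n k, (n0 <= n)%N -> (n <= k)%N -> e k <= e n.
Proof.
move=> he n k n0n /subnKC <-.
elim: (k - n)%N => [|j IH]; first by rewrite addn0.
by rewrite addnS (le_trans (he _ _))// (leq_trans n0n)// leq_addr.
Qed.

Lemma powR_vanish e (n1 : nat) (q : R) :
  0 < q -> (forall n, (n1 <= n)%N -> 0 <= e n) ->
  (forall n k, (n1 <= n)%N -> (n <= k)%N -> e k <= e n) ->
  (forall eta : R, 0 < eta -> exists2 k, (n1 <= k)%N & e k < eta) ->
  forall eta : R, 0 < eta ->
    exists2 k, (n1 <= k)%N & forall n, (k <= n)%N -> e n `^ q < eta.
Proof.
move=> q0 e0 edec he eta eta0; have [|k n1k hk] := he (eta `^ q^-1).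
  by rewrite powR_gt0.
exists k => // n kn; have n1n := leq_trans n1k kn.
have -> : eta = (eta `^ q^-1) `^ q.
  by rewrite -powRrM mulVf ?lt0r_neq0// powRr1// ltW.
by rewrite gt0_ltr_powR ?nnegrE ?powR_ge0 ?e0// (le_lt_trans (edec _ _ n1k kn)).
Qed.

Lemma steps_vanish e w (n1 : nat) (D : R) :
  0 < D -> (forall n, 0 <= w n) -> (forall n, (n1 <= n)%N -> 0 <= e n) ->
  (forall n, (n1 <= n)%N -> D * w n ^+ 2 <= e n - e n.+1) ->
  (forall n k, (n1 <= n)%N -> (n <= k)%N -> e k <= e n) ->
  (forall eta : R, 0 < eta -> exists2 k, (n1 <= k)%N & e k < eta) ->
  forall eta : R, 0 < eta ->
    exists2 k, (n1 <= k)%N & forall n, (k <= n)%N -> w n < eta.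
Proof.
move=> D0 w0 e0 hD edec he eta eta0; have [|k n1k hk] := he (D * eta ^+ 2).
  by rewrite mulr_gt0// exprn_gt0.
exists k => // n kn; have n1n := leq_trans n1k kn.
rewrite -(@ltr_pXn2r _ 2) ?nnegrE ?(ltW eta0)// -(ltr_pM2l D0).
have := hD n n1n; have := e0 n.+1 (leqW n1n); have := edec _ _ n1k kn; lra.
Qed.

(** The abstract trapping argument. In the application [r n] is the distance from [z_n] to the limit
    point; the Lojasiewicz inequality is available only while [r n < eps], so staying within this
    radius has to be proved along with the length bound. *)
Lemma lojasiewicz_finite_length (d : nat) (x : nat -> 'rV[R]_d) (xs : 'rV[R]_d)
    e w (r : nat -> R) (n1 : nat) (theta D K c eps : R) :
  0 <= theta < 1 -> 0 < D -> 0 < K -> 0 <= c -> 0 < eps ->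
  (forall n, (n1 <= n)%N -> 0 <= e n) ->
  (forall n, (n1 <= n)%N -> D * w n ^+ 2 <= e n - e n.+1) ->
  (forall n, (n1 <= n)%N -> r n < eps -> pow00 (e n) theta <= K * w n) ->
  (forall n, enorm (x n.+1 - x n) <= w n) ->
  (forall n, (n1 <= n)%N -> r n <= 2 * enorm (x n - xs) + c * w n) ->
  (forall eta : R, 0 < eta -> exists2 k, (n1 <= k)%N & e k < eta) ->
  (forall (eta : R) n, 0 < eta ->
    exists2 k, (n <= k)%N & enorm (x k - xs) < eta) ->
  exists n0 C, [/\ (n1 <= n0)%N, 0 < C & forall n, (n0 <= n)%N ->
    [/\ pow00 (e n) theta <= K * w n,
        enorm (x n - xs) <= C * e n `^ (1 - theta) &
        w n <= C * e n `^ (1 - theta)]].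
Proof.
move=> th D0 K0 c0 eps0 e0 hD hloja hx hr he hclus.
have q0 : 0 < 1 - theta by case/andP: th => _; rewrite subr_gt0.
have w0 n : 0 <= w n by exact: le_trans (enorm_ge0 _) (hx n).
have edec := @nonincreasing_from e n1.
have {}edec : forall n k, (n1 <= n)%N -> (n <= k)%N -> e k <= e n.
  apply: edec => n nn; have := hD n nn; have := sqr_ge0 (w n); nra.
pose C := K / (D * (1 - theta)).
have C0 : 0 < C by rewrite divr_gt0// mulr_gt0.
have stepw n : (n1 <= n)%N -> r n < eps ->
    w n <= C * (e n `^ (1 - theta) - e n.+1 `^ (1 - theta)).
  move=> n1n rn; apply: lojasiewicz_step => //.
  - exact: e0.
  - by rewrite e0// ltnW.
  - exact: hD.
  - exact: hloja.
clearbody C.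
have phi_small := powR_vanish q0 e0 edec he.
have w_small := steps_vanish D0 w0 e0 hD edec he.
(* Error budget: [x n] stays within [eps / 8] of [x n0], which is within [eps / 8] of [xs], and
   [c * w n <= eps / 4]; thus [r n] is below [2 * (eps / 4) + eps / 4 < eps]. The divisor [c + 1]
   covers [c = 0]. *)
have eps8C : 0 < eps / (8 * C) by rewrite divr_gt0// mulr_gt0.
have [k1 n1k1 hk1] := phi_small _ eps8C.
have c10 : 0 < c + 1 by rewrite ltr_wpDl.
have eps4c : 0 < eps / (4 * (c + 1)) by rewrite divr_gt0// mulr_gt0.
have [k2 n1k2 hk2] := w_small _ eps4c.
have eps8 : 0 < eps / 8 by rewrite divr_gt0.
have [n0 hn0 hxn0] := hclus _ (maxn k1 k2) eps8.
move: hn0; rewrite geq_max => /andP[k1n0 k2n0].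
have n1n0 := leq_trans n1k1 k1n0.
have near_r n : (n0 <= n)%N -> enorm (x n - x n0) <= eps / 8 -> r n < eps.
  move=> n0n hxn; apply: le_lt_trans (hr n (leq_trans n1n0 n0n)) _.
  have h1 := enorm_triangle (x n) (x n0) xs.
  have h2 : c * w n <= eps / 4.
    have := hk2 n (leq_trans k2n0 n0n); rewrite ltr_pdivlMr ?mulr_gt0//.
    have := w0 n; nra.
  lra.
have Ce0 : C * e n0 `^ (1 - theta) < eps / 8.
  have := hk1 n0 k1n0.
  by rewrite !ltr_pdivlMr ?mulr_gt0// mulrCA mulrC (mulrC _ C).
(* Simultaneous induction: [r n < eps] permits one more telescoping step, and the telescoped length,
   at most [C * e n0 ^ (1 - theta) < eps / 8], gives [r n.+1 < eps]. *)
have main j : r (n0 + j)%N < eps /\ enorm (x (n0 + j)%N - x n0) <=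
    C * (e n0 `^ (1 - theta) - e (n0 + j)%N `^ (1 - theta)).
  elim: j => [|j [rj IH]].
    rewrite addn0 !subrr mulr0 enorm0; split=> //.
    by apply: near_r => //; rewrite subrr enorm0 ltW.
  rewrite addnS; set n := (n0 + j)%N in rj IH *.
  have n0n : (n0 <= n)%N by rewrite leq_addr.
  have n1n := leq_trans n1n0 n0n.
  have hxn : enorm (x n.+1 - x n0) <=
      C * (e n0 `^ (1 - theta) - e n.+1 `^ (1 - theta)).
    apply: le_trans (enorm_triangle _ (x n) _) _.
    have := stepw n n1n rj; have := hx n; lra.
  split=> //; apply: near_r; first exact: leqW.
  apply: le_trans hxn _; have := powR_ge0 (e n.+1) (1 - theta); nra.
have rn n : (n0 <= n)%N -> r n < eps.
  by move=> /subnKC <-; case: (main (n - n0)%N).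
exists n0, C; split=> // n n0n.
have n1n := leq_trans n1n0 n0n.
split; first by apply: hloja => //; exact: rn.
  (* Telescoping from [n] to a later [k] with [x k] within [eta] of [xs], then letting [eta] tend to
     0. *)
  apply/ler_addgt0Pr => eta eta0.
  have [k nk hk] := hclus eta n eta0.
  have h j : enorm (x n - x (n + j)%N) <=
      C * (e n `^ (1 - theta) - e (n + j)%N `^ (1 - theta)).
    elim: j => [|j IH]; first by rewrite addn0 !subrr mulr0 enorm0.
    apply: le_trans (enorm_triangle _ (x (n + j)%N) _) _.
    rewrite addnS (enormBC (x (n + j)%N)).
    have nj := leq_addr j n.
    have := stepw (n + j)%N (leq_trans n1n nj) (rn _ (leq_trans n0n nj)).
    have := hx (n + j)%N; lra.
  have := h (k - n)%N; rewrite subnKC// => hnk.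
  apply: le_trans (enorm_triangle _ (x k) _) _.
  have := powR_ge0 (e k) (1 - theta); nra.
have := stepw n n1n (rn n n0n); have := powR_ge0 (e n.+1) (1 - theta); nra.
Qed.

(** * Decay rates from recursive inequalities *)

Lemma linear_rate e (n0 : nat) (M : R) :
  1 < M -> (forall n, (n0 <= n)%N -> 0 <= e n) ->
  (forall n, (n0 <= n)%N -> e n <= M * (e n - e n.+1)) ->
  exists2 a, 0 < a & forall n, (n0 <= n)%N -> e n <= a * (1 - M^-1) ^+ n.
Proof.
move=> M1 e0 he; have M0 : 0 < M by lra.
set Q := 1 - M^-1.
have Q0 : 0 < Q by rewrite subr_gt0 invf_lt1.
(* The division moves the start from [n0] to 0; the summand 1 keeps the constant positive when
   [e n0 = 0]. *)
exists ((e n0 + 1) / Q ^+ n0).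
  by rewrite divr_gt0 ?exprn_gt0// ltr_wpDl// e0.
have h j : e (n0 + j)%N <= (e n0 + 1) * Q ^+ j.
  elim: j => [|j IH]; first by rewrite addn0 mulr1 lerDl.
  rewrite addnS exprSr mulrA.
  apply: le_trans (ler_wpM2r (ltW Q0) IH).
  have := he (n0 + j)%N (leq_addr _ _).
  rewrite -ler_pdivrMl// /Q => h; lra.
move=> n /subnKC <-; apply: le_trans (h _) _.
by rewrite exprD mulrA divfK// expf_neq0// gt_eqF.
Qed.

Lemma sublinear_rate e (n0 : nat) (M p : R) :
  0 < M -> 0 < p -> (forall n, (n0 <= n)%N -> 0 <= e n) ->
  (forall n, (n0 <= n)%N -> e n `^ (p + 1) <= M * (e n - e n.+1)) ->
  exists2 b, 0 < b & exists k : nat, (n0 <= k)%N /\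
    forall n, (k <= n)%N -> e n <= b * n%:R `^ (- (1 / p)).
Proof.
move=> M0 p0 e0 he.
have edec := @nonincreasing_from e n0.
have {}edec : forall n k, (n0 <= n)%N -> (n <= k)%N -> e k <= e n.
  apply: edec => n nn; have := he n nn; have := powR_ge0 (e n) (p + 1).
  move=> h1 h2; have : 0 <= M * (e n - e n.+1) by lra.
  by rewrite pmulr_rge0// subr_ge0.
(* Once [e] vanishes it stays 0 by monotonicity; otherwise its negative powers make sense. *)
have [[k [n0k ek]]|hpos] := pselect (exists k, (n0 <= k)%N /\ e k = 0).
  exists 1 => //; exists k; split=> // n kn.
  by rewrite (le_trans (edec _ _ n0k kn))// ek mul1r powR_ge0.
have {}hpos n : (n0 <= n)%N -> 0 < e n.
  move=> nn; rewrite lt0r e0// andbT; apply/eqP => en.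
  by apply: hpos; exists n.
(* Convexity of [t ^ (- p)] and the recursion make [e n ^ (- p)] grow by at least [p / M] per
   step. *)
have step j : p / M * j%:R <= e (n0 + j)%N `^ (- p).
  elim: j => [|j IH]; first by rewrite mulr0 powR_ge0.
  rewrite addnS -natr1 mulrDr mulr1.
  set n := (n0 + j)%N in IH *; have nn : (n0 <= n)%N by rewrite leq_addr.
  have := powRN_diff_ge (hpos n nn) (hpos n.+1 (leqW nn)) (ltW p0).
  suff : p / M <= p * e n `^ (- (p + 1)) * (e n - e n.+1) by lra.
  rewrite -mulrA ler_pM2l// powRN.
  have E0 : 0 < e n `^ (p + 1) by rewrite powR_gt0// hpos.
  by rewrite ler_pdivlMl// ler_pdivrMr// mulrC he.
(* The factor 1/2 pays for replacing [n - n0] by [n / 2], valid for [n >= 2 * n0]; the extra 1 in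
   the threshold below makes [n] positive. *)
pose c := p / M / 2.
have c0 : 0 < c by rewrite !divr_gt0.
exists (c `^ (- (1 / p))); first by rewrite powR_gt0.
exists (n0 * 2 + 1)%N; split; first by lia.
move=> n hn.
have nn : (n0 <= n)%N by lia.
have n_gt0 : 0 < n%:R :> R by rewrite ltr0n; lia.
rewrite -powRM ?(ltW c0)//.
have hc : c * n%:R <= e n `^ (- p).
  have := step (n - n0)%N; rewrite subnKC//; apply: le_trans.
  have pM0 : 0 < p / M by rewrite divr_gt0.
  rewrite /c -[leLHS]mulrA (ler_pM2l pM0) ler_pdivrMl// -natrM ler_nat; lia.
clearbody c.
have -> : e n = (e n `^ (- p)) `^ (- (1 / p)).
  by rewrite -powRrM mulrNN mulrCA divff ?gt_eqF// mulr1 powRr1// ltW// hpos.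
rewrite !(powRN _ (1 / p)) lef_pV2 ?posrE ?powR_gt0 ?mulr_gt0 ?hpos//.
have ip0 : 0 <= 1 / p by rewrite divr_ge0 ?(ltW p0).
by rewrite ge0_ler_powR ?nnegrE ?powR_ge0// mulr_ge0 ?(ltW c0).
Qed.

(** Squaring the Lojasiewicz inequality allows [w] to be eliminated through the decrease, leaving a
    recursion in the energy alone. *)
Lemma sqr_lojasiewicz (theta D K a b w : R) :
  0 < theta -> 0 < D -> 0 < K -> 0 <= w ->
  D * w ^+ 2 <= a - b -> pow00 a theta <= K * w ->
  a `^ (2 * theta) <= K ^+ 2 / D * (a - b).
Proof.
move=> th0 D0 K0 w0 hD; rewrite pow00E// => hK.
rewrite mulrC powRrM (powR_mulrn 2) ?powR_ge0//.
apply: (@le_trans _ _ ((K * w) ^+ 2)).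
  by rewrite ler_pXn2r ?nnegrE ?powR_ge0// mulr_ge0// ltW.
by rewrite exprMn -mulrA ler_pM2l ?exprn_gt0// ler_pdivlMl.
Qed.

Lemma lojasiewicz_linear_rate e w (n0 : nat) (theta D K : R) :
  0 < theta <= 1 / 2 -> 0 < D -> 0 < K -> (forall n, 0 <= w n) ->
  (forall n, (n0 <= n)%N -> 0 <= e n) -> (forall n, (n0 <= n)%N -> e n <= 1) ->
  (forall n, (n0 <= n)%N -> D * w n ^+ 2 <= e n - e n.+1) ->
  (forall n, (n0 <= n)%N -> pow00 (e n) theta <= K * w n) ->
  exists Q a, [/\ 0 <= Q < 1, 0 < a & forall n, (n0 <= n)%N ->
    e n <= a * Q ^+ n /\
    e n `^ (1 - theta) <= a `^ (1 / 2) * Q `^ (n%:R / 2)].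
Proof.
move=> /andP[th0 th12] D0 K0 w0 e0 e1 hD hK.
(* The summand 2 ensures [1 < M], so that the ratio [1 - M^-1] is positive. *)
pose M := K ^+ 2 / D + 2.
have KD0 : 0 < K ^+ 2 / D by rewrite divr_gt0 ?exprn_gt0.
have M1 : 1 < M by rewrite /M; lra.
have [|a a0 ha] := linear_rate M1 e0.
  move=> n n0n.
  have h := sqr_lojasiewicz th0 D0 K0 (w0 n) (hD n n0n) (hK n n0n).
  (* For an energy at most 1, lowering the exponent raises the power; [2 * theta <= 1] is used here,
     and [1 / 2 <= 1 - theta] in the second bound. *)
  have h1 : e n <= e n `^ (2 * theta).
    have [->|en] := eqVneq (e n) 0; first exact: powR_ge0.
    by apply: ger1_powR; [rewrite lt0r en e0//= e1|lra].
  have := hD n n0n; have := sqr_ge0 (w n); rewrite /M; nra.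
have M0 : 0 < M by lra.
exists (1 - M^-1), a; split=> //.
  by rewrite subr_ge0 ltrBlDr ltrDl invr_gt0 M0 invf_le1// ltW.
move=> n n0n; split; first exact: ha.
have Q0 : 0 <= 1 - M^-1 by rewrite subr_ge0 invf_le1// ltW.
rewrite mul1r powRrM powR_mulrn// -powRM ?(ltW a0) ?exprn_ge0//.
have [->|en] := eqVneq (e n) 0.
  by rewrite powR0 ?powR_ge0// gt_eqF//; lra.
apply: (@le_trans _ _ (e n `^ 2^-1)).
  by apply: ger_powR; [rewrite lt0r en e0//= e1|lra].
by rewrite ge0_ler_powR ?nnegrE ?e0 ?ha ?mulr_ge0 ?(ltW a0) ?exprn_ge0.
Qed.

(** This is [sublinear_rate] with [p = 2 * theta - 1]; the second bound is the power [1 - theta] of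
    the first. *)
Lemma lojasiewicz_sublinear_rate e w (n0 : nat) (theta D K : R) :
  1 / 2 < theta < 1 -> 0 < D -> 0 < K -> (forall n, 0 <= w n) ->
  (forall n, (n0 <= n)%N -> 0 <= e n) ->
  (forall n, (n0 <= n)%N -> D * w n ^+ 2 <= e n - e n.+1) ->
  (forall n, (n0 <= n)%N -> pow00 (e n) theta <= K * w n) ->
  exists2 b, 0 < b & exists k : nat, (n0 <= k)%N /\ forall n, (k <= n)%N ->
    e n <= b * n%:R `^ (- (1 / (2 * theta - 1))) /\
    e n `^ (1 - theta)
      <= b `^ (1 - theta) * n%:R `^ ((theta - 1) / (2 * theta - 1)).
Proof.
move=> /andP[th12 th1] D0 K0 w0 e0 hD hK.
have th0 : 0 < theta by lra.
have p0 : 0 < 2 * theta - 1 by lra.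
have KD0 : 0 < K ^+ 2 / D by rewrite divr_gt0 ?exprn_gt0.
have [|b b0 [k [n0k hk]]] := sublinear_rate KD0 p0 e0.
  move=> n n0n; rewrite subrK.
  exact: sqr_lojasiewicz th0 D0 K0 (w0 n) (hD n n0n) (hK n n0n).
exists b => //; exists k; split=> // n kn; split; first exact: hk.
have n0n := leq_trans n0k kn.
have -> : (theta - 1) / (2 * theta - 1) =
    - (1 / (2 * theta - 1)) * (1 - theta) by field; rewrite gt_eqF.
rewrite powRrM -powRM ?powR_ge0 ?(ltW b0)//.
rewrite ge0_ler_powR ?nnegrE ?e0 ?hk ?mulr_ge0 ?powR_ge0 ?(ltW b0)//.
by rewrite subr_ge0 ltW.
Qed.

End lojasiewicz_sequences.

(** * The energy of the inertial iteration *)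

Section coefficient_asymptotics.
Variables (R : realType) (alpha beta s Lg : R).
Hypotheses (alpha_gt0 : 0 < alpha) (beta_itv : 0 < beta < 1) (s_gt0 : 0 < s).

(** The momentum coefficient of the iteration. The coefficients A, B, C are polynomials in one or
    two consecutive values of it, which yields their limits and reduces the energy identity to
    algebra. *)
Definition inertia (n : nat) : R := beta * n%:R / (n%:R + alpha).

Let kappa : R := (2 - s * Lg) / (2 * s).

Let natD_gt0 n : 0 < n%:R + alpha :> R.
Proof. by rewrite ltr_wpDl. Qed.

Lemma inertia_ge0_le1 n : 0 <= inertia n <= 1.
Proof.
case/andP: beta_itv => b0 b1.
rewrite /inertia divr_ge0 ?mulr_ge0 ?(ltW b0) ?(ltW (natD_gt0 n))//=.
rewrite ler_pdivrMr// mul1r.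
have b10 : 0 <= 1 - beta by lra.
by have := mulr_ge0 b10 (ler0n R n); move: alpha_gt0; lra.
Qed.

Lemma coefAE n : coefA alpha beta s Lg n =
  kappa * (1 + inertia n.+1) ^+ 2 - inertia n.+1 * (1 + inertia n.+1) / s.
Proof.
have h := natD_gt0 n.+1; rewrite /coefA /kappa /inertia.
move: (n.+1%:R) h => t h; field.
by rewrite (gt_eqF s_gt0) (gt_eqF h).
Qed.

Lemma coefBE n : Defs.coefB alpha beta s Lg n = kappa * inertia n ^+ 2.
Proof. by []. Qed.

Lemma coefCE n : Defs.coefC alpha beta s Lg n =
  kappa * inertia n * (1 + inertia n.+1) - inertia n * inertia n.+1 / (2 * s).
Proof.
have h := natD_gt0 n.+1; have h' := natD_gt0 n.
rewrite /Defs.coefC /kappa /inertia.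
have -> : beta * n.+1%:R - beta = beta * n%:R by rewrite -natr1; ring.
have -> : n.+1%:R + alpha - 1 = n%:R + alpha by rewrite -natr1; ring.
move: (n.+1%:R) (n%:R) h h' => t t' h h'; field.
by rewrite (gt_eqF s_gt0) (gt_eqF h) (gt_eqF h').
Qed.

(* With A, B, C the three coefficients, C_n - B_n = delta_n - slack_n and
   A_n - C_n = delta_(n+1) + slack_(n+1). *)
Definition slack n : R := 1 / 2 *
  (coefA alpha beta s Lg n.-1 - Defs.coefC alpha beta s Lg n.-1
   + Defs.coefB alpha beta s Lg n - Defs.coefC alpha beta s Lg n).

Lemma cvg_inertia : inertia n @[n --> \oo] --> beta.
Proof.
case/andP: beta_itv => b0 b1.
apply/cvgrPdist_le => /= e e0; near=> n.
have h := natD_gt0 n.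
have -> : beta - inertia n = beta * alpha / (n%:R + alpha).
  by rewrite /inertia; field; rewrite gt_eqF.
rewrite ger0_norm ?divr_ge0 ?mulr_ge0 ?(ltW h) ?(ltW b0) ?(ltW alpha_gt0)//.
rewrite ler_pdivrMr//.
have : alpha / e <= n%:R by near: n; exact: nbhs_infty_ger.
rewrite ler_pdivrMr// => hn; move: alpha_gt0; nra.
Unshelve. all: by end_near. Qed.

Let cvg_inertiaS : inertia n.+1 @[n --> \oo] --> beta.
Proof. by rewrite (cvg_shiftS inertia); exact: cvg_inertia. Qed.

Lemma cvg_coefA : coefA alpha beta s Lg n @[n --> \oo] -->
  kappa * (1 + beta) ^+ 2 - beta * (1 + beta) / s.
Proof.
have h : 1 + inertia n.+1 @[n --> \oo] --> 1 + beta.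
  by apply: cvgD => //; exact: cvg_cst.
under eq_fun do rewrite coefAE expr2.
rewrite expr2.
exact: (cvgB (cvgM (cvg_cst _) (cvgM h h))
  (cvgM (cvgM cvg_inertiaS h) (cvg_cst _))).
Qed.

Lemma cvg_coefB :
  Defs.coefB alpha beta s Lg n @[n --> \oo] --> kappa * beta ^+ 2.
Proof.
under eq_fun do rewrite coefBE expr2.
rewrite expr2.
exact: (cvgM (cvg_cst _) (cvgM cvg_inertia cvg_inertia)).
Qed.

Lemma cvg_coefC : Defs.coefC alpha beta s Lg n @[n --> \oo] -->
  kappa * beta * (1 + beta) - beta * beta / (2 * s).
Proof.
under eq_fun do rewrite coefCE.
have h : 1 + inertia n.+1 @[n --> \oo] --> 1 + beta.
  by apply: cvgD => //; exact: cvg_cst.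
exact: (cvgB (cvgM (cvgM (cvg_cst _) cvg_inertia) h)
  (cvgM (cvgM cvg_inertia cvg_inertiaS) (cvg_cst _))).
Qed.

Lemma coef_eventually : s * Lg < 2 * (1 - beta) ->
  exists n1 D M, [/\ 0 < D, 0 < M & forall n, (n1 <= n)%N ->
    [/\ D <= slack n, 0 <= Defs.coefC alpha beta s Lg n &
        delta alpha beta s Lg n <= M]].
Proof.
case/andP: beta_itv => b0 b1 sL.
have cB : Defs.coefB alpha beta s Lg n.+1 @[n --> \oo] --> kappa * beta ^+ 2.
  by rewrite (cvg_shiftS (Defs.coefB _ _ _ _)); exact: cvg_coefB.
have cC : Defs.coefC alpha beta s Lg n.+1 @[n --> \oo] -->
    kappa * beta * (1 + beta) - beta * beta / (2 * s).
  by rewrite (cvg_shiftS (Defs.coefC _ _ _ _)); exact: cvg_coefC.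
(* The limit of [slack]; its positivity is exactly the step size condition. *)
pose S := (2 * (1 - beta) - s * Lg) / (4 * s).
have S0 : 0 < S by rewrite divr_gt0 ?mulr_gt0// subr_gt0.
have cS : slack n.+1 @[n --> \oo] --> S.
  rewrite (_ : S = 1 / 2 * (kappa * (1 + beta) ^+ 2 - beta * (1 + beta) / s
    - (kappa * beta * (1 + beta) - beta * beta / (2 * s)) + kappa * beta ^+ 2
    - (kappa * beta * (1 + beta) - beta * beta / (2 * s)))); last first.
    by rewrite /S /kappa; field; rewrite gt_eqF.
  exact: (cvgM (cvg_cst _) (cvgB (cvgD (cvgB cvg_coefA cvg_coefC) cB) cC)).
pose T := 1 / 2 * (kappa * (1 + beta) ^+ 2 - beta * (1 + beta) / s
    - (kappa * beta * (1 + beta) - beta * beta / (2 * s)) - kappa * beta ^+ 2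
    + (kappa * beta * (1 + beta) - beta * beta / (2 * s))).
have cT : delta alpha beta s Lg n.+1 @[n --> \oo] --> T.
  exact: (cvgM (cvg_cst _) (cvgD (cvgB (cvgB cvg_coefA cvg_coefC) cB) cC)).
have C0 : 0 < kappa * beta * (1 + beta) - beta * beta / (2 * s).
  rewrite (_ : _ - _ = beta / (2 * s) * ((2 - s * Lg) * (1 + beta) - beta)).
    by rewrite mulr_gt0 ?divr_gt0 ?mulr_gt0//; nra.
  by rewrite /kappa; field; rewrite gt_eqF.
clearbody S T.
have [n1 _ h1] : \forall n \near \oo, [/\ S / 2 <= slack n.+1,
    0 <= Defs.coefC alpha beta s Lg n.+1 &
    delta alpha beta s Lg n.+1 <= `|T| + 1].
  near=> n; split; near: n.
  - apply: (cvgr_ge S) => //; lra.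
  - exact: (cvgr_ge _ cC).
  - by apply: (cvgr_le T) => //; have := ler_norm T; lra.
(* The limits were taken at [n.+1], where the predecessors inside [slack] and [delta] disappear;
   hence the threshold is shifted by one. *)
exists n1.+1, (S / 2), (`|T| + 1); split; rewrite ?divr_gt0 ?ltr_wpDl//.
by case=> // n nn; exact: h1.
Unshelve. all: by end_near. Qed.

End coefficient_asymptotics.

(** * Decrease of the energy in one iteration *)

Section energy_decrease.
Variables (R : realType) (m : nat) (g : 'rV[R]_m -> R).
Variables (Lg alpha beta s : R) (xm1 : 'rV[R]_m) (x y : nat -> 'rV[R]_m).
Hypotheses (g_diff : forall p : 'rV[R]_m, differentiable g p)
  (g_lip : lipschitz_grad g Lg) (alpha_gt0 : 0 < alpha) (s_gt0 : 0 < s).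
Hypothesis y_def : forall n,
  y n = x n + inertia alpha beta n *: (x n - xprev xm1 x n).
Hypothesis x_rec : forall n, x n.+1 = y n - s *: grad g (y n).

Definition incr n := x n - xprev xm1 x n.

Lemma grad_y n :
  grad g (y n) = s^-1 *: (inertia alpha beta n *: incr n - incr n.+1).
Proof.
have -> : inertia alpha beta n *: incr n - incr n.+1 = s *: grad g (y n).
  rewrite /incr /= x_rec {1}y_def.
  rewrite opprD addrA; apply/rowP => i; rewrite !mxE /=; ring.
by rewrite scalerA mulVf ?gt_eqF// scale1r.
Qed.

(** With [d = incr n] and [d' = incr n.+1], the upper bound for [g (y n.+1) - g (y n)] in the
    descent lemma is the quadratic form [- A_n |d'|^2 + 2 C_n <d', d> - B_n |d|^2]. Polarization,
    [2 <d', d> = |d'|^2 + |d|^2 - |d' - d|^2], turns its coefficients into [A_n - C_n] and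
    [C_n - B_n], that is, into [delta] and [slack]. *)
Lemma energy_decrease n :
  g (y n.+1) + delta alpha beta s Lg n.+1 * enorm (incr n.+1) ^+ 2
  + slack alpha beta s Lg n.+1 * enorm (incr n.+1) ^+ 2
  + slack alpha beta s Lg n * enorm (incr n) ^+ 2
  + Defs.coefC alpha beta s Lg n * enorm (incr n.+1 - incr n) ^+ 2
  <= g (y n) + delta alpha beta s Lg n * enorm (incr n) ^+ 2.
Proof.
have := descent_lemma (y n) (y n.+1) g_diff g_lip.
have -> : y n.+1 - y n =
    (1 + inertia alpha beta n.+1) *: incr n.+1 - inertia alpha beta n *: incr n.
  rewrite !y_def /incr /=; apply/rowP => i; rewrite !mxE; ring.
rewrite grad_y; move: (incr n.+1) (incr n) => d' d.
rewrite !sqr_enorm !(dotDl, dotDr, dotNl, dotNr, dotZl, dotZr) (dotC d d').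
rewrite /delta /slack /= !coefCE ?coefAE ?coefBE //.
set a := inertia alpha beta n; set b := inertia alpha beta n.+1.
set p := dot d' d'; set q := dot d' d; set r := dot d d.
(* These values cancel in [delta + slack] at [n.+1] and in [delta - slack] at [n], so they can be
   arbitrary. *)
move: (inertia alpha beta n.+2) (inertia alpha beta n.-1.+1)
  (inertia alpha beta n.-1) (g (y n)) (g (y n.+1)) => b' a'' a' G G'.
rewrite -subr_ge0 => descent; rewrite -subr_ge0.
apply: le_trans descent _; rewrite le_eqVlt; apply/orP; left; apply/eqP.
by field; rewrite gt_eqF.
Qed.

End energy_decrease.

(** * Convergence of the iterates *)

Lemma omega_enorm (R : realType) (d : nat) (z : nat -> 'rV[R]_d)
    (zs : 'rV[R]_d) : omega z zs ->
  forall (eta : R) (n : nat), 0 < eta ->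
    exists2 k, (n <= k)%N & enorm (z k - zs) < eta.
Proof.
move=> zzs eta n eta0.
(* The Euclidean norm is at most [d] times the sup norm; [d.+1] avoids a zero divisor. *)
have rho0 : 0 < eta / d.+1%:R by rewrite divr_gt0.
have [||_ /= [[k nk <-] hk]] := zzs [set z k | k in [set k | (n <= k)%N]]
    (ball zs (eta / d.+1%:R)).
- have : \forall k \near \oo, [set z k | k in [set k | (n <= k)%N]] (z k).
    by near=> k; exists k => //=; near: k; exact: nbhs_infty_ge.
  by [].
- exact: nbhsx_ballx.
exists k => //; move: hk; rewrite -ball_normE /= ltr_pdivlMr// => hk.
rewrite enormBC; apply: le_lt_trans (enorm_le_norm _) (le_lt_trans _ hk).
by rewrite mulrC ler_wpM2l// ler_nat.
Unshelve. all: by end_near. Qed.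

Lemma continuous_enorm (R : realType) (d : nat) (f : 'rV[R]_d -> R)
    (u : 'rV[R]_d) : {for u, continuous f} ->
  forall eta : R, 0 < eta ->
    exists2 rho : R, 0 < rho &
      forall v, enorm (v - u) < rho -> `|f v - f u| < eta.
Proof.
move=> fc eta eta0.
have : \forall v \near u, `|f u - f v| < eta.
  by move/cvgrPdist_lt : fc; apply.
move=> /nbhs_ballP[rho rho0 h].
exists rho => // v hv; rewrite distrC; apply: h.
rewrite -ball_normE /= (le_lt_trans (norm_le_enorm _))//.
by rewrite enormBC.
Qed.

(** * Energy and distance bounds along the iteration *)

Section inertial_gradient.
Variables (R : realType) (m : nat) (g : 'rV[R]_m -> R).
Variables (Lg alpha beta s : R) (xm1 : 'rV[R]_m) (x y : nat -> 'rV[R]_m).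
Variables (N : nat) (K theta : R) (xs : 'rV[R]_m).
Hypotheses (g_diff : forall p : 'rV[R]_m, differentiable g p)
  (g_lip : lipschitz_grad g Lg) (alpha_gt0 : 0 < alpha)
  (beta_itv : 0 < beta < 1) (s_gt0 : 0 < s)
  (sL : s * Lg < 2 * (1 - beta)).
Hypothesis y_def : forall n,
  y n = x n + inertia alpha beta n *: (x n - xprev xm1 x n).
Hypothesis x_rec : forall n, x n.+1 = y n - s *: grad g (y n).
Hypothesis delta_gt0 : forall n, (N <= n)%N -> 0 < delta alpha beta s Lg n.
Hypothesis zs_omega :
  omega (zseq alpha beta s Lg xm1 x y N) (row_mx xs xs).
Hypothesis H_loja : lojasiewicz_at (Hfun g) (row_mx xs xs) K theta.

Let d n := incr xm1 x n.
Let u n := useq alpha beta s Lg xm1 x y n.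
Let z n := row_mx (y n) (u n).
Let zs := row_mx xs xs.
Let w n := enorm (d n) + enorm (d n.+1).
Let e n := g (y n) + delta alpha beta s Lg n * enorm (d n) ^+ 2 - g xs.

Let w_ge0 n : 0 <= w n.
Proof. by rewrite addr_ge0 ?enorm_ge0. Qed.

Let d_le_w n : enorm (d n) <= w n.
Proof. by rewrite lerDl enorm_ge0. Qed.

Let dS_le_w n : enorm (d n.+1) <= w n.
Proof. by rewrite lerDr enorm_ge0. Qed.

Let inertia_d n : enorm (inertia alpha beta n *: d n) <= enorm (d n).
Proof.
have /andP[b0 b1] := inertia_ge0_le1 alpha_gt0 beta_itv n.
by rewrite enormZ ger0_norm// ler_piMl// enorm_ge0.
Qed.

Let yBx n : enorm (y n - x n) <= w n.
Proof. by rewrite y_def addrAC subrr add0r (le_trans (inertia_d n) (d_le_w n)). Qed.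

Let grad_y_le n : enorm (grad g (y n)) <= w n / s.
Proof.
rewrite (grad_y s_gt0 y_def x_rec).
rewrite enormZ gtr0_norm ?invr_gt0// mulrC ler_pM2r ?invr_gt0//.
by apply: le_trans (enormB _ _) _; rewrite lerD2r inertia_d.
Qed.

Let uBy n : u n - y n = Num.sqrt (2 * delta alpha beta s Lg n) *: d n.
Proof. by rewrite /u /useq addrAC subrr add0r. Qed.

(** The factor [sqrt (2 * delta)] in [u n] is what turns the quadratic part of [H] into
    [delta * |d n|^2]; [N <= n] makes the radicand nonnegative. *)
Let Hfun_z n : (N <= n)%N -> Hfun g (z n) - Hfun g zs = e n.
Proof.
move=> Nn; rewrite /Hfun !row_mxKl !row_mxKr subrr enorm0 enormBC uBy.
rewrite enormZ exprMn real_normK ?num_real// sqr_sqrtr; last first.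
  by rewrite mulr_ge0// ltW// delta_gt0.
by rewrite /e; field.
Qed.

(** Reduces the theorem to a single scalar sequence: all four quantities are dominated by [e n] or
    [e n ^ (1 - theta)], so the three cases of [theta] differ only in how fast [e] decays. *)
Lemma inertial_gradient_bounds : exists (e w : nat -> R) n0 D K' C c1,
  [/\ [/\ 0 < D, 0 < K', 0 < C & 0 < c1],
    forall n, 0 <= w n /\ enorm (grad g (y n)) <= w n / s,
    forall eta : R, 0 < eta -> exists2 k, (n0 <= k)%N & forall n, (k <= n)%N ->
      [/\ e n < eta, w n < eta & C * e n `^ (1 - theta) < eta] &
    forall n, (n0 <= n)%N ->
      [/\ 0 <= e n, D * w n ^+ 2 <= e n - e n.+1,
          pow00 (e n) theta <= K' * w n &
          [/\ g (y n) - g xs <= e n, g (x n) - g xs <= c1 * e n,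
              enorm (x n - xs) <= C * e n `^ (1 - theta) &
              enorm (y n - xs) <= C * e n `^ (1 - theta)]]].
Proof.
have [n1 [D [M [D0 M0 hcoef]]]] :=
  coef_eventually alpha_gt0 beta_itv s_gt0 sL.
have [K0 th [eps eps0 hloja]] := H_loja.
set n2 := maxn n1 N.
have n12 n : (n2 <= n)%N -> (n1 <= n)%N by rewrite geq_max => /andP[].
have N2 n : (n2 <= n)%N -> (N <= n)%N by rewrite geq_max => /andP[].
have D20 : 0 < D / 2 by rewrite divr_gt0.
have hD n : (n2 <= n)%N -> D / 2 * w n ^+ 2 <= e n - e n.+1.
  move=> n2n.
  have [S1 C1 _] := hcoef n (n12 n n2n).
  have [S2 _ _] := hcoef n.+1 (leqW (n12 n n2n)).
  (* The nonnegative [C_n] term is dropped; [(p + q)^2 <= 2 * (p^2 + q^2)] explains the constant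
     [D / 2]. *)
  have := le_trans (ler_wpDr (mulr_ge0 C1 (sqr_ge0 _)) (lexx _))
    (energy_decrease g_diff g_lip alpha_gt0 s_gt0 y_def x_rec n).
  rewrite /e /w -/(d n) -/(d n.+1).
  generalize (enorm (d n)) (enorm (d n.+1)) (slack alpha beta s Lg n)
    (slack alpha beta s Lg n.+1) S1 S2 => p q S S' hS hS' hE.
  have h2 := ler_wpM2r (sqr_ge0 p) hS.
  have h3 := ler_wpM2r (sqr_ge0 q) hS'.
  have h4 : D / 2 * (p + q) ^+ 2 <= D * p ^+ 2 + D * q ^+ 2.
    have := mulr_ge0 (ltW D20) (sqr_ge0 (p - q)); lra.
  lra.
have edec : forall n k, (n2 <= n)%N -> (n <= k)%N -> e k <= e n.
  apply: nonincreasing_from => n n2n.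
  have := hD n n2n; have := mulr_ge0 (ltW D20) (sqr_ge0 (w n)); lra.
have zclus (eta : R) n : 0 < eta ->
    exists2 k, (n <= k)%N & (N <= k)%N /\ enorm (z k - zs) < eta.
  move=> eta0; have [k nk hk] := omega_enorm zs_omega n eta0.
  exists (k + N)%N; first exact: leq_trans nk (leq_addr _ _).
  by split => //; exact: leq_addl.
have [Hdiff _] := grad_Hfun xs xs g_diff.
have eclus (eta : R) n : 0 < eta -> exists2 k, (n <= k)%N & `|e k| < eta.
  move=> eta0.
  have [rho rho0 hrho] :=
    continuous_enorm (differentiable_continuous Hdiff) eta0.
  have [k nk [Nk hk]] := zclus rho n rho0.
  by exists k => //; rewrite -Hfun_z//; exact: hrho.
(* [e] is nonincreasing and, by continuity of [H] at the cluster point, comes arbitrarily close to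
   0; hence it cannot become negative. *)
have e0 n : (n2 <= n)%N -> 0 <= e n.
  move=> n2n; apply/ler_addgt0Pr => eta eta0.
  have [k nk hk] := eclus eta n eta0.
  have := edec n k n2n nk; move: hk; rewrite ltr_norml => /andP[]; lra.
have he (eta : R) : 0 < eta -> exists2 k, (n2 <= k)%N & e k < eta.
  move=> eta0; have [k nk hk] := eclus eta n2 eta0.
  by exists k => //; exact: le_lt_trans (ler_norm _) hk.
have w_small := steps_vanish D20 w_ge0 e0 hD edec he.
have uy n : (n2 <= n)%N -> enorm (u n - y n) <= Num.sqrt (2 * M) * w n.
  move=> n2n; rewrite uBy enormZ ger0_norm ?sqrtr_ge0//.
  apply: ler_pM; rewrite ?sqrtr_ge0 ?enorm_ge0//.
  by apply: ler_wsqrtr; rewrite ler_pM2l//; case: (hcoef n (n12 n n2n)).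
set c := Num.sqrt (2 * M) in uy.
have c0 : 0 <= c by exact: sqrtr_ge0.
clearbody c.
have yxs n : enorm (y n - xs) <= enorm (x n - xs) + w n.
  have := enorm_triangle (y n) (x n) xs; have := yBx n; lra.
have hr n : (n2 <= n)%N ->
    enorm (z n - zs) <= 2 * enorm (x n - xs) + (2 + c) * w n.
  move=> n2n; rewrite /z /zs opp_row_mx add_row_mx.
  apply: le_trans (enorm_row_mx_le _ _) _.
  have := enorm_triangle (u n) (y n) xs.
  have := uy n n2n; have := yxs n; lra.
(* The gradient of [H] at [z n] is the pair [grad g (y n) + (y n - u n)], [u n - y n], of norm at
   most [w n / s + 2 * c * w n]. *)
pose K1 := s^-1 + 2 * c.
have K10 : 0 < K1 by rewrite ltr_wpDr ?invr_gt0// mulr_ge0.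
have hK n : (n2 <= n)%N -> enorm (z n - zs) < eps ->
    pow00 (e n) theta <= K * K1 * w n.
  move=> n2n hz; have := hloja (z n) hz.
  rewrite Hfun_z ?N2// ger0_norm ?e0// => /le_trans; apply.
  rewrite -mulrA ler_pM2l//.
  have [_ ->] := grad_Hfun (y n) (u n) g_diff.
  apply: le_trans (enorm_row_mx_le _ _) _.
  have := enormD (grad g (y n)) (y n - u n).
  rewrite (enormBC (y n) (u n)).
  have := uy n n2n; have := grad_y_le n; rewrite /K1; lra.
(* The cluster point is one of [z], hence of [y]; it passes to [x] because [y k - x k] is bounded by
   [w k], which tends to 0. *)
have xclus (eta : R) n : 0 < eta ->
    exists2 k, (n <= k)%N & enorm (x k - xs) < eta.
  move=> eta0; have eta20 : 0 < eta / 2 by rewrite divr_gt0.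
  have [k1 n2k1 hk1] := w_small _ eta20.
  have [k nk [_ hk]] := zclus _ (maxn n k1) eta20.
  move: nk; rewrite geq_max => /andP[nk k1k]; exists k => //.
  have := hk1 k k1k; have := yBx k; have := enorm_triangle (x k) (y k) xs.
  move: hk; rewrite /z /zs opp_row_mx add_row_mx (enormBC (x k) (y k)).
  have := enorm_le_row_mx (y k - xs) (u k - xs); lra.
have KK1 : 0 < K * K1 by rewrite mulr_gt0.
have c20 : 0 <= 2 + c by rewrite addr_ge0.
have [n0 [C [n20 C0 hC]]] := @lojasiewicz_finite_length R m x xs e w
  (fun n => enorm (z n - zs)) n2 theta _ _ _ _ th D20 KK1 c20 eps0 e0 hD hK
  dS_le_w hr he xclus.
have [Lg0 _] := g_lip.
(* [2 * C] comes from [|y n - xs| <= |x n - xs| + w n]. For the last constant, the descent lemma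
   bounds [g (x n) - g (y n)] by [(s^-1 + Lg / 2) * w n ^+ 2], and the decrease gives
   [w n ^+ 2 <= e n / (D / 2)]. *)
exists e, w, n0, (D / 2), (K * K1), (2 * C), (1 + (s^-1 + Lg / 2) / (D / 2)).
have sLg : 0 <= s^-1 + Lg / 2.
  by rewrite addr_ge0 ?divr_ge0 ?invr_ge0 ?(ltW s_gt0).
split.
- by split=> //; rewrite ?mulr_gt0// ltr_wpDr// divr_ge0// ltW.
- by move=> n; split; [exact: w_ge0|exact: grad_y_le].
- move=> eta eta0; have [k1 n2k1 hk1] := w_small _ eta0.
  have [k2 n2k2 hk2] := he _ eta0.
  have C20 : 0 < 2 * C by rewrite mulr_gt0.
  have q0 : 0 < 1 - theta by case/andP: th => _; rewrite subr_gt0.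
  have [k3 n2k3 hk3] := powR_vanish q0 e0 edec he (divr_gt0 eta0 C20).
  exists (maxn n0 (maxn k1 (maxn k2 k3))); first exact: leq_maxl.
  move=> n; rewrite !geq_max => /and4P[_ k1n k2n k3n]; split; last 2 first.
  + exact: hk1.
  + by have := hk3 n k3n; rewrite ltr_pdivlMr// mulrC.
  + exact: le_lt_trans (edec _ _ n2k2 k2n) hk2.
- move=> n n0n; have n2n := leq_trans n20 n0n.
  have [h1 h2 h3] := hC n n0n.
  have gy : g (y n) - g xs <= e n.
    rewrite /e lerD2r lerDl mulr_ge0 ?sqr_ge0// ltW// delta_gt0//.
    exact: N2.
  split=> //; [exact: e0|exact: hD|split=> //].
  + have := descent_lemma (y n) (x n) g_diff g_lip.
    have := dot_le (grad g (y n)) (x n - y n).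
    rewrite (enormBC (x n) (y n)) => hdot hdesc.
    have hdw : dot (grad g (y n)) (x n - y n) <= w n / s * w n.
      apply: le_trans hdot _.
      by apply: ler_pM; rewrite ?enorm_ge0.
    have hyw : Lg / 2 * enorm (y n - x n) ^+ 2 <= Lg / 2 * w n ^+ 2.
      by rewrite ler_wpM2l ?divr_ge0// ler_pXn2r ?nnegrE ?enorm_ge0.
    have hw : w n ^+ 2 <= e n / (D / 2).
      rewrite ler_pdivlMr// mulrC; have := hD n n2n.
      have := e0 n.+1 (leqW n2n); lra.
    have := ler_wpM2l sLg hw.
    move: ((D / 2)^-1) => I; lra.
  + apply: le_trans h2 _; rewrite ler_wpM2r ?powR_ge0//; lra.
  + apply: le_trans (yxs n) _; lra.
Qed.

End inertial_gradient.

Theorem theorem19 (R : realType) (m : nat) (g : 'rV[R]_m -> R)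
    (Lg alpha beta s : R) (xm1 x0 : 'rV[R]_m) (x y : nat -> 'rV[R]_m)
    (N : nat) (K theta : R) (xstar : 'rV[R]_m)
    (g_diff : forall p : 'rV[R]_m, differentiable g p)
    (g_lip : lipschitz_grad g Lg)
    (alpha_gt0 : 0 < alpha)
    (beta_itv : 0 < beta < 1)
    (s_gt0 : 0 < s)
    (* for Lg = 0 the bound 2 (1 - beta) / Lg is +oo *)
    (s_lt : 0 < Lg -> s < 2 * (1 - beta) / Lg)
    (x_init : x 0%N = x0)
    (y_def : forall n : nat,
      y n = x n + (beta * n%:R / (n%:R + alpha)) *: (x n - xprev xm1 x n))
    (x_rec : forall n : nat, x n.+1 = y n - s *: grad g (y n))
    (g_lb : has_lbound (range g))
    (N_ge1 : (1 <= N)%N)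
    (delta_gt0 : forall n : nat, (N <= n)%N -> 0 < delta alpha beta s Lg n)
    (energy_noninc : nonincreasing_seq (fun n : nat =>
      g (y (n + N)%N) + delta alpha beta s Lg (n + N)
        * enorm (x (n + N)%N - xprev xm1 x (n + N)) ^+ 2))
    (omega_neq0 : omega (zseq alpha beta s Lg xm1 x y N) !=set0)
    (zstar_omega :
      omega (zseq alpha beta s Lg xm1 x y N) (row_mx xstar xstar))
    (H_loja : lojasiewicz_at (Hfun g) (row_mx xstar xstar) K theta) :
  [/\ x @ \oo --> xstar,
      grad g xstar = 0,
      theta = 0 ->
        [/\ converges_finitely (g \o y), converges_finitely (g \o x),
            converges_finitely y & converges_finitely x],
      0 < theta <= 1 / 2 ->
        exists Q a1 a2 a3 a4 : R, exists kbar : nat,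
          [/\ 0 <= Q < 1, [/\ 0 < a1, 0 < a2, 0 < a3 & 0 < a4] &
              forall n : nat, (kbar <= n)%N ->
                [/\ g (y n) - g xstar <= a1 * Q ^+ n,
                    g (x n) - g xstar <= a2 * Q ^+ n,
                    enorm (x n - xstar) <= a3 * Q `^ (n%:R / 2) &
                    enorm (y n - xstar) <= a4 * Q `^ (n%:R / 2)]] &
      1 / 2 < theta < 1 ->
        exists b1 b2 b3 b4 : R, exists kbar : nat,
          [/\ 0 < b1, 0 < b2, 0 < b3, 0 < b4 &
              forall n : nat, (kbar <= n)%N ->
                [/\ g (y n) - g xstar <= b1 * n%:R `^ (- (1 / (2 * theta - 1))),
                    g (x n) - g xstar <= b2 * n%:R `^ (- (1 / (2 * theta - 1))),
                    enorm (x n - xstar)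
                      <= b3 * n%:R `^ ((theta - 1) / (2 * theta - 1)) &
                    enorm (y n - xstar)
                      <= b4 * n%:R `^ ((theta - 1) / (2 * theta - 1))]]].
Proof.
have sL : s * Lg < 2 * (1 - beta).
  have [Lg0 _] := g_lip; have b1 : beta < 1 by case/andP: beta_itv.
  move: Lg0; rewrite le_eqVlt => /predU1P[<-|Lg0].
    by rewrite mulr0 mulr_gt0// subr_gt0.
  by rewrite -ltr_pdivlMr// s_lt.
have [e [w [n0 [D [K' [C [c1 [[D0 K'0 C0 c10] w0 small H]]]]]]]] :=
  inertial_gradient_bounds g_diff g_lip alpha_gt0 beta_itv s_gt0 sL y_def x_rec
    delta_gt0 zstar_omega H_loja.
have [_ /andP[th0 th1] _] := H_loja.
have q0 : 0 < 1 - theta by rewrite subr_gt0.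
have e0 n : (n0 <= n)%N -> 0 <= e n by case/H.
have wge0 n : 0 <= w n by case: (w0 n).
have hD n : (n0 <= n)%N -> D * w n ^+ 2 <= e n - e n.+1 by case/H.
have hK n : (n0 <= n)%N -> pow00 (e n) theta <= K' * w n by case/H.
(* Transfers decay of the energy to the four quantities of the statement; both rate regimes use
   it. *)
have rates (phi psi : nat -> R) k : (n0 <= k)%N ->
    (forall n, (k <= n)%N -> e n <= phi n /\ e n `^ (1 - theta) <= psi n) ->
    forall n, (k <= n)%N ->
      [/\ g (y n) - g xstar <= phi n, g (x n) - g xstar <= c1 * phi n,
          enorm (x n - xstar) <= C * psi n & enorm (y n - xstar) <= C * psi n].
  move=> n0k hk n kn; have [he hp] := hk n kn.
  have [_ _ _ [h1 h2 h3 h4]] := H n (leq_trans n0k kn).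
  split; first exact: le_trans h1 he.
  - by apply: le_trans h2 _; rewrite ler_pM2l.
  - by apply: le_trans h3 _; rewrite ler_pM2l.
  - by apply: le_trans h4 _; rewrite ler_pM2l.
split.
- apply/cvgrPdist_lt => /= eta eta0; have [k n0k hk] := small eta eta0.
  near=> n.
  have kn : (k <= n)%N by near: n; exact: nbhs_infty_ge.
  have [_ _ _ [_ _ h3 _]] := H n (leq_trans n0k kn).
  rewrite distrC (le_lt_trans (norm_le_enorm _))//.
  by apply: le_lt_trans h3 _; case: (hk n kn).
- have [Lg0 lip] := g_lip.
  apply: enorm_eq0; apply/eqP; rewrite eq_le enorm_ge0 andbT.
  apply/ler_addgt0Pr => eta eta0; rewrite add0r.
  have cst0 : 0 < Lg + s^-1 by rewrite ltr_wpDl ?invr_gt0.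
  (* [|grad g xstar| <= Lg * |y k - xstar| + w k / s], whence the divisor [Lg + s^-1]. *)
  have [k n0k hk] := small _ (divr_gt0 eta0 cst0).
  have [_ hw hC] := hk k (leqnn k).
  have [_ _ _ [_ _ _ h4]] := H k n0k.
  have [_ hg] := w0 k.
  have := enormD (grad g xstar - grad g (y k)) (grad g (y k)).
  rewrite subrK => /le_trans; apply.
  have := lip xstar (y k); rewrite (enormBC xstar) => hl.
  set rho := eta / _ in hw hC.
  have h5 : Lg * enorm (y k - xstar) <= Lg * rho.
    by rewrite ler_wpM2l// (le_trans h4)// ltW.
  have h6 : w k / s <= rho * s^-1 by rewrite ler_pM2r ?invr_gt0// ltW.
  have -> : eta = Lg * rho + rho * s^-1.
    by rewrite [Lg * _]mulrC -mulrDr /rho divfK// gt_eqF.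
  by apply: lerD; [exact: le_trans hl h5|exact: le_trans hg h6].
- move=> theta0.
  (* For [theta = 0] a nonzero energy would give [1 <= K' * w n], impossible once [w n < K'^-1]. So
     [e n = 0], and the distance bounds force both iterates to equal [xstar]. *)
  have [k n0k hk] := small K'^-1 (ltac:(by rewrite invr_gt0)).
  have ek n : (k <= n)%N -> e n = 0.
    move=> kn; apply/eqP; apply: contraTT isT => en.
    have := hK n (leq_trans n0k kn).
    rewrite /pow00 (negPf en) theta0 powRr0 => h.
    have [_ hw _] := hk n kn.
    by move: hw; rewrite -(ltr_pM2l K'0) mulfV ?gt_eqF// ltNge h.
  have xy n : (k <= n)%N -> x n = xstar /\ y n = xstar.
    move=> kn; have [_ _ _ [_ _ h3 h4]] := H n (leq_trans n0k kn).
    rewrite ek// powR0 ?gt_eqF// mulr0 in h3 h4.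
    by split; apply/eqP; rewrite -subr_eq0; apply/eqP/enorm_eq0/eqP;
      rewrite eq_le enorm_ge0 ?h3 ?h4.
  split; [exists (g xstar), k|exists (g xstar), k|exists xstar, k|
    exists xstar, k] => n /xy[xn yn] //=; by rewrite ?xn ?yn.
- move=> th12.
  (* The linear regime compares powers of [e n] and so starts where [e n <= 1]. *)
  have [k n0k hk] := small 1 ltr01.
  have [||||Q [a [Q01 a0 ha]]] :=
    @lojasiewicz_linear_rate R e w k theta D K' th12 D0 K'0 wge0.
  + by move=> n kn; apply: e0; exact: leq_trans kn.
  + by move=> n kn; case: (hk n kn) => /ltW.
  + by move=> n kn; apply: hD; exact: leq_trans kn.
  + by move=> n kn; apply: hK; exact: leq_trans kn.
  have a20 : 0 < C * a `^ (1 / 2) by rewrite mulr_gt0// powR_gt0.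
  exists Q, a, (c1 * a), (C * a `^ (1 / 2)), (C * a `^ (1 / 2)), k.
  split=> //; first by split=> //; rewrite mulr_gt0.
  by move=> n kn; have := rates _ _ k n0k ha n kn; rewrite !mulrA.
- move=> th12.
  have [b b0 [k [n0k hk]]] :=
    lojasiewicz_sublinear_rate th12 D0 K'0 wge0 e0 hD hK.
  have b20 : 0 < C * b `^ (1 - theta) by rewrite mulr_gt0// powR_gt0.
  exists b, (c1 * b), (C * b `^ (1 - theta)), (C * b `^ (1 - theta)), k.
  split=> //; first by rewrite mulr_gt0.
  by move=> n kn; have := rates _ _ k n0k hk n kn; rewrite !mulrA.
Unshelve. all: by end_near. Qed.
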